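(* Let $K=\mathbb{Q}_2(\omega)$, where $\omega^2+\omega+1=0$ (so $K=\mathbb{Q}_2(\sqrt{-3})$ is the unramified quadratic extension of $\mathbb{Q}_2$). Then $\{2,4\omega\}$ is a $\mathbb{Z}_2$-basis of $\log_{\mathcal{M}}(\mathfrak{m}_K)$.
   Context: For a finite extension $K$ of $\mathbb{Q}_2$, $\mathfrak{m}_K$ is the maximal ideal of its ring of integers. For $x\in\mathfrak{m}_K$, $\log_{\mathcal{M}}(x)=\log_2(1+x)=\sum_{n\ge 1}(-1)^{n-1}\frac{x^n}{n}\in K$ (convergent $2$-adic logarithm series), and $\log_{\mathcal{M}}(\mathfrak{m}_K)=\log_2(1+\mathfrak{m}_K)$ denotes the image of $\mathfrak{m}_K$; it is a $\mathbb{Z}_2$-submodule of $K$. *)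

(* Defs.v *)
From HB Require Import structures.
From mathcomp Require Import all_boot all_order all_algebra falgebra fieldext.
From mathcomp Require Import boolp classical_sets.

Set Implicit Arguments.
Unset Strict Implicit.
Unset Printing Implicit Defensive.

Import Order.TTheory GRing.Theory Num.Theory.
Local Open Scope classical_set_scope.
Local Open Scope ring_scope.

(* Z_2 is the inverse limit of the rings Z/2^n: the n-th component is recorded
   by its canonical representative in [0, 2^n), so that the single equation
   below says both that the component is reduced and that the components are
   compatible. *)
Record padic2 := Padic2 {
  residue : nat -> int;
  _ : `[< forall n, residue n = (residue n.+1 %% 2 ^+ n)%Z >] }.

HB.instance Definition _ := [isSub for residue].
HB.instance Definition _ := [Choice of padic2 by <:].

Lemma residueS (x : padic2) n : residue x n = (residue x n.+1 %% 2 ^+ n)%Z.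
Proof. by case: x => u hu; exact: (elimT (asboolP _) hu). Qed.

Lemma residue_mod (x : padic2) n : (residue x n %% 2 ^+ n)%Z = residue x n.
Proof. by rewrite residueS modz_mod. Qed.

Lemma modz_modd (m d k : int) : (k %| d)%Z -> ((m %% d)%Z = m %[mod k])%Z.
Proof.
move=> k_d; apply/esym/eqP; rewrite eqz_mod_dvd {1}(divz_eq m d) addrK.
exact: dvdz_mull.
Qed.

Lemma residueD (x : padic2) n k : residue x n = (residue x (n + k)%N %% 2 ^+ n)%Z.
Proof.
elim: k => [|k IHk]; first by rewrite addn0 residue_mod.
by rewrite IHk residueS modz_modd ?addnS // exprD dvdz_mulr.
Qed.

Lemma padic2P (x y : padic2) :
  (forall n, residue x n = residue y n) -> x = y.
Proof. by move=> exy; apply/val_inj/funext. Qed.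

Fact mk_padic2_subproof (u : nat -> int) :
  (forall n, u n = u n.+1 %[mod 2 ^+ n])%Z ->
  `[< forall n, (u n %% 2 ^+ n)%Z = ((u n.+1 %% 2 ^+ n.+1)%Z %% 2 ^+ n)%Z >].
Proof.
by move=> hu; apply/asboolP => n; rewrite modz_modd ?hu // exprS dvdz_mull.
Qed.

Definition mk_padic2 (u : nat -> int)
    (hu : (forall n, u n = u n.+1 %[mod 2 ^+ n])%Z) : padic2 :=
  @Padic2 (fun n => (u n %% 2 ^+ n)%Z) (mk_padic2_subproof hu).

Fact int_padic2_subproof (a : int) n : (a = a %[mod 2 ^+ n])%Z.
Proof. by []. Qed.

Definition int_padic2 (a : int) : padic2 := mk_padic2 (int_padic2_subproof a).

Fact add_padic2_subproof (x y : padic2) n :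
  (residue x n + residue y n = residue x n.+1 + residue y n.+1 %[mod 2 ^+ n])%Z.
Proof. by rewrite (residueS x) (residueS y) modzDm. Qed.

Definition add_padic2 x y : padic2 := mk_padic2 (add_padic2_subproof x y).

Fact opp_padic2_subproof (x : padic2) n :
  (- residue x n = - residue x n.+1 %[mod 2 ^+ n])%Z.
Proof. by rewrite (residueS x) modzNm. Qed.

Definition opp_padic2 x : padic2 := mk_padic2 (opp_padic2_subproof x).

Fact mul_padic2_subproof (x y : padic2) n :
  (residue x n * residue y n = residue x n.+1 * residue y n.+1 %[mod 2 ^+ n])%Z.
Proof. by rewrite (residueS x) (residueS y) modzMm. Qed.

Definition mul_padic2 x y : padic2 := mk_padic2 (mul_padic2_subproof x y).

Fact padic2_addA : associative add_padic2.
Proof.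
by move=> x y z; apply: padic2P => n /=; rewrite modzDml modzDmr addrA.
Qed.

Fact padic2_addC : commutative add_padic2.
Proof. by move=> x y; apply: padic2P => n /=; rewrite addrC. Qed.

Fact padic2_add0 : left_id (int_padic2 0) add_padic2.
Proof. by move=> x; apply: padic2P => n /=; rewrite modzDml add0r residue_mod. Qed.

Fact padic2_addN : left_inverse (int_padic2 0) opp_padic2 add_padic2.
Proof. by move=> x; apply: padic2P => n /=; rewrite modzDml addNr. Qed.

HB.instance Definition _ := GRing.isZmodule.Build padic2
  padic2_addA padic2_addC padic2_add0 padic2_addN.

Fact padic2_mulA : associative mul_padic2.
Proof.
by move=> x y z; apply: padic2P => n /=; rewrite modzMml modzMmr mulrA.
Qed.

Fact padic2_mulC : commutative mul_padic2.
Proof. by move=> x y; apply: padic2P => n /=; rewrite mulrC. Qed.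

Fact padic2_mul1 : left_id (int_padic2 1) mul_padic2.
Proof. by move=> x; apply: padic2P => n /=; rewrite modzMml mul1r residue_mod. Qed.

Fact padic2_mulD : left_distributive mul_padic2 add_padic2.
Proof.
move=> x y z; apply: padic2P => n /=.
by rewrite modzMml modzDm mulrDl.
Qed.

Fact padic2_1neq0 : int_padic2 1 != 0.
Proof. by apply/eqP => /(congr1 (fun x => residue x 1%N)). Qed.

HB.instance Definition _ := GRing.Zmodule_isComNzRing.Build padic2
  padic2_mulA padic2_mulC padic2_mul1 padic2_mulD padic2_1neq0.

Definition padic2_unit : {pred padic2} :=
  [pred x | `[< exists y : padic2, y * x = 1 >]].

Definition padic2_inv (x : padic2) : padic2 :=
  xget x [set y : padic2 | y * x = 1].

Fact padic2_mulV : {in padic2_unit, left_inverse 1 padic2_inv *%R}.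
Proof. by move=> x /asboolP ex_y; exact: (xgetPex x ex_y). Qed.

Fact padic2_unitP (x y : padic2) : y * x = 1 -> padic2_unit x.
Proof. by move=> yx1; apply/asboolP; exists y. Qed.

Fact padic2_inv_out : {in [predC padic2_unit], padic2_inv =1 id}.
Proof.
move=> x nUx; apply: xgetPN => y yx1.
by move/negP: nUx; apply; apply: padic2_unitP yx1.
Qed.

HB.instance Definition _ := GRing.ComNzRing_hasMulInverse.Build padic2
  padic2_mulV padic2_unitP padic2_inv_out.

Lemma padic2_neq0 (x : padic2) :
  x != 0 -> exists n, ~~ (2 ^+ n %| residue x n)%Z.
Proof.
move=> nz_x; apply: contrapT => all_dvd; case/eqP: nz_x; apply: padic2P => n.
rewrite /= mod0z -residue_mod; apply/dvdz_mod0P/negPn/negP => ndvd.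
by apply: all_dvd; exists n.
Qed.

Lemma ndvdz_exp2M (a b : int) m n :
  ~~ (2 ^+ m %| a)%Z -> ~~ (2 ^+ n %| b)%Z -> ~~ (2 ^+ (m + n) %| a * b)%Z.
Proof.
rewrite !dvdzE !abszX abszM /= => a_m b_n.
have [a0|a_gt0] := posnP `|a|%N; first by rewrite a0 dvdn0 in a_m.
have [b0|b_gt0] := posnP `|b|%N; first by rewrite b0 dvdn0 in b_n.
move: a_m b_n; rewrite !pfactor_dvdn ?muln_gt0 ?a_gt0 // lognM // -!ltnNge.
by move=> a_m b_n; rewrite -addSn leq_add // ltnW.
Qed.

Fact padic2_integral : GRing.integral_domain_axiom padic2.
Proof.
move=> x y xy0; apply/negPn/negP; rewrite negb_or => /andP[].
move=> /padic2_neq0[m ndvd_m] /padic2_neq0[n ndvd_n].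
have /dvdz_mod0P : (residue x (m + n)%N * residue y (m + n)%N %% 2 ^+ (m + n))%Z = 0.
  by have /(congr1 (fun z => residue z (m + n)%N))/= := xy0; rewrite mod0z.
apply/negP/ndvdz_exp2M.
  by apply: contra ndvd_m => /dvdz_mod0P; rewrite -residueD => ->; rewrite dvdz0.
apply: contra ndvd_n => /dvdz_mod0P.
by rewrite addnC -residueD => ->; rewrite dvdz0.
Qed.

HB.instance Definition _ :=
  GRing.ComUnitRing_isIntegral.Build padic2 padic2_integral.

Notation Z_2 := padic2.
Notation Q_2 := {fraction padic2}.

Section FiniteExtension.
Variable K : fieldExtType Q_2.

Definition Z2_to (a : Z_2) : K := (FracField.tofrac a)%:A.

Definition ring_of_integers : set K := [set x | integralOver Z2_to x].

Definition is_ideal (A I : set K) : Prop :=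
  [/\ I `<=` A, I 0, forall x y, I x -> I y -> I (x + y)
    & forall a x, A a -> I x -> I (a * x)].

Definition is_maximal_ideal (A I : set K) : Prop :=
  [/\ is_ideal A I, I <> A
    & forall J, is_ideal A J -> I `<=` J -> J = I \/ J = A].

(* The ring of integers of a finite extension of Q_2 is local, so that this
   definite description picks its only maximal ideal. *)
Definition max_ideal : set K :=
  xget set0 [set I | is_maximal_ideal ring_of_integers I].

(* Convergence for the 2-adic topology of K: the sets 2^k O_K form a basis of
   neighbourhoods of 0. *)
Definition converges_to (u : nat -> K) (l : K) : Prop :=
  forall k : nat, exists N : nat, forall n : nat, (N <= n)%N ->
    ring_of_integers ((u n - l) / 2 ^+ k).

Definition log_partial_sum (x : K) (N : nat) : K :=
  \sum_(1 <= n < N.+1) (-1) ^+ n.-1 * (x ^+ n / n%:R).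

(* Sum of the series, with the dummy value 0 if it diverges; it converges
   whenever x lies in max_ideal. *)
Definition logM (x : K) : K :=
  xget 0 [set l | converges_to (log_partial_sum x) l].

Definition is_Z2_basis n (M : set K) (e : n.-tuple K) : Prop :=
  (forall a : 'I_n -> Z_2,
     \sum_(i < n) Z2_to (a i) * tnth e i = 0 -> forall i, a i = 0) /\
  M = [set x | exists a : 'I_n -> Z_2, x = \sum_(i < n) Z2_to (a i) * tnth e i].

End FiniteExtension.

Arguments ring_of_integers K : clear implicits.
Arguments max_ideal K : clear implicits.

(* Main.v *)
Require Import Defs.
From HB Require Import structures.
From mathcomp Require Import all_boot all_order all_algebra falgebra fieldext.
From mathcomp Require Import boolp classical_sets.
From mathcomp Require Import ring zify.

Set Implicit Arguments.
Unset Strict Implicit.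
Unset Printing Implicit Defensive.

Import Order.TTheory GRing.Theory Num.Theory.
Local Open Scope classical_set_scope.
Local Open Scope ring_scope.

(** Write A for Z_2[omega].  The theorem compares log (1 + m_K) with the lattice
    2 Z_2 + 4 omega Z_2 = 2 Z_2 + 4 A.  That 2 and 4 omega are independent over
    Z_2 is the anisotropy of the norm form a^2 - a b + b^2 of a + b omega
    ([eis_free]); the equality of the two sets rests on three facts.

    The ring of integers is A and its maximal ideal is 2 A
    ([ring_of_integersE], [max_idealE]).  The norm of a + b omega is odd unless
    a and b are both even, so an element of A is either divisible by 2 or
    a unit; hence every x in K outside A has its inverse in 2 A, and such an x
    cannot be a root of a monic polynomial over Z_2.

    For x in A, log (1 + 2 x) = 2 (x - x^2) mod 4 A, since all later terms
    of the series lie in 4 A ([logM_mod4]).  In the residue field F_4,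
    x - x^2 = x + x^2 is the trace of x to F_2, hence 0 or 1.  This gives the
    inclusion into 2 Z_2 + 4 A ([logM_image_sub]); as x = 0 and x = omega give
    the values 0 and 1, both classes of (2 Z_2 + 4 A) / 4 A are met.

    Every class modulo 4 A that the logarithm meets lies in its image, by Newton
    iteration: for d in 2^k A with k > 0, log (1 + 2 (x + d)) agrees with
    log (1 + 2 x) + 2 d modulo 2^(k+2) A ([logM_increment]), so an approximate
    preimage can be improved by one binary digit at a time ([logM_lift]).  The
    increment estimate is made term by term: a = b mod 2^k implies
    a^n = b^n mod 2^(k + v_2(n)), and the v_2(n) digits so gained pay for the
    denominator n of the logarithm series ([eis_pow2_expB]). *)

(** * The 2-adic integers *)

Lemma padic2_residueM (x y : Z_2) n :
  residue (x * y) n = (residue x n * residue y n %% 2 ^+ n)%Z.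
Proof. by []. Qed.

Lemma padic2_residue_exp2 m n : residue (2 ^+ m : Z_2) n = (2 ^+ m %% 2 ^+ n)%Z.
Proof.
elim: m => [//|m IHm].
by rewrite !exprS padic2_residueM IHm modzMmr /= modzDm modzMml.
Qed.

(** Links the two descriptions of the 2-adic topology of Z_2: the inverse limit
    and the powers of 2.  Dividing by 2^n loses n binary digits, so the m-th
    residue of the quotient is read off from the (n + m)-th residue of x. *)
Lemma padic2_dvdP (x : Z_2) n :
  residue x n = 0 <-> exists c, x = 2 ^+ n * c.
Proof.
split=> [x0 | [c ->]]; last first.
  by rewrite padic2_residueM padic2_residue_exp2 modzz mul0r mod0z.
have dvd_x m : (2 ^+ n %| residue x (n + m)%N)%Z.
  by apply/dvdz_mod0P; rewrite -residueD.
have nz2n m : (2 ^+ m : int) != 0 by rewrite expf_neq0.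
have cE m : (2 ^+ n * (residue x (n + m)%N %/ 2 ^+ n)%Z = residue x (n + m)%N).
  by rewrite mulrC divzK.
have compat m : ((residue x (n + m)%N %/ 2 ^+ n)%Z
                = (residue x (n + m.+1)%N %/ 2 ^+ n)%Z %[mod 2 ^+ m])%Z.
  apply/eqP; rewrite eqz_mod_dvd -(@dvdz_mul2l (2 ^+ n)) ?nz2n //.
  by rewrite mulrBr !cE -exprD -eqz_mod_dvd addnS residueS modz_mod.
exists (mk_padic2 compat); apply: padic2P => m.
rewrite padic2_residueM padic2_residue_exp2 modzMml /= modzMmr cE.
by rewrite addnC -residueD.
Qed.

Lemma padic2_separated (x : Z_2) :
  (forall n, exists c, x = 2 ^+ n * c) -> x = 0.
Proof.
by move=> dvd_x; apply: padic2P => n; rewrite /= mod0z; apply/padic2_dvdP.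
Qed.

Lemma padic2_complete (u : nat -> Z_2) :
  (forall n, exists c, u n.+1 - u n = 2 ^+ n * c) ->
  exists l, forall n, exists c, l - u n = 2 ^+ n * c.
Proof.
move=> cau_u.
have compat n : (residue (u n) n = residue (u n.+1) n.+1 %[mod 2 ^+ n])%Z.
  have /padic2_dvdP/= du := cau_u n.
  apply/esym/eqP; rewrite eqz_mod_dvd; apply/dvdz_mod0P.
  move: du; rewrite (residueS (u n.+1)) modzDm.
  exact.
exists (mk_padic2 compat) => n; apply/padic2_dvdP => /=.
by rewrite modzDm subrr mod0z.
Qed.

Lemma padic2_parity (x : Z_2) : exists c, x = 2 * c \/ x = 1 + 2 * c.
Proof.
have half y : residue y 1 = 0 -> exists c : Z_2, y = 2 * c.
  by move=> /padic2_dvdP; rewrite expr1.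
have : (residue x 1 == 0) || (residue x 1 == 1).
  rewrite -residue_mod expr1.
  have := @modz_ge0 (residue x 1) 2 isT.
  by have := @ltz_pmod (residue x 1) 2 isT; lia.
case/orP => /eqP x1; first by have [c ->] := half x x1; exists c; left.
have [|c xE] := half (x - 1); first by rewrite /= x1.
by exists c; right; rewrite -xE addrC subrK.
Qed.

Lemma padic2_two_neq0 : (2 : Z_2) != 0.
Proof. by apply/eqP => /(congr1 (fun x => residue x 2)). Qed.

(** The inverse of 1 + 2 t is the sum of the geometric series of ratio - 2 t. *)
Lemma padic2_odd_unit (t : Z_2) : exists v, v * (1 + 2 * t) = 1.
Proof.
pose u n : Z_2 := \sum_(i < n) (- (2 * t)) ^+ i.
have uE n : u n * (1 + 2 * t) = 1 - (- (2 * t)) ^+ n.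
  by apply: oppr_inj; rewrite opprB subrX1 -/(u n); ring.
have [|v v_u] := @padic2_complete u.
  move=> n; rewrite /u big_ord_recr /= addrAC subrr add0r -mulrN.
  by rewrite exprMn; eexists.
exists v; apply/subr0_eq/padic2_separated => n.
have [c vE] := v_u n; rewrite -[v](subrK (u n)) vE mulrDl uE.
rewrite -mulrN exprMn; exists (c * (1 + 2 * t) - (- t) ^+ n); ring.
Qed.

(** The form a^2 - a b + b^2 is the norm of a + b omega; it is anisotropic modulo
    2 because X^2 + X + 1 has no root in F_2. *)
Lemma padic2_norm_odd (a b : Z_2) :
  (exists a', a = 2 * a') /\ (exists b', b = 2 * b') \/
  exists t, a ^+ 2 - a * b + b ^+ 2 = 1 + 2 * t.
Proof.
have [a' aE] := padic2_parity a; have [b' bE] := padic2_parity b.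
case: aE bE => -> [] ->.
- by left; split; eexists.
- right; exists (2 * a'^+2 - a' * (1 + 2 * b') + 2 * b' + 2 * b' ^+ 2); ring.
- right; exists (2 * b'^+2 - b' * (1 + 2 * a') + 2 * a' + 2 * a' ^+ 2); ring.
- right; exists (a' + b' + 2 * a' ^+ 2 + 2 * b' ^+ 2 - 2 * a' * b'); ring.
Qed.

(** Infinite descent: a zero of the norm form has both coordinates even, and
    halving it gives another zero. *)
Lemma padic2_norm_eq0 (a b : Z_2) :
  a ^+ 2 - a * b + b ^+ 2 = 0 -> a = 0 /\ b = 0.
Proof.
move=> ab0.
have odd_neq0 (t : Z_2) : 1 + 2 * t <> 0.
  have [v vt] := padic2_odd_unit t; move=> t0.
  by move/eqP: vt; rewrite t0 mulr0 eq_sym oner_eq0.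
have div n : exists a' b', [/\ a = 2 ^+ n * a', b = 2 ^+ n * b'
                           & a' ^+ 2 - a' * b' + b' ^+ 2 = 0].
  elim: n => [|n [a' [b' [-> -> ab'0]]]]; first by exists a, b; rewrite !mul1r.
  case: (padic2_norm_odd a' b') => [[[a'' a'E] [b'' b'E]] | [t]]; last first.
    by rewrite ab'0 => /esym/odd_neq0.
  exists a'', b''; rewrite a'E b'E !exprSr !mulrA; split=> //.
  apply: (mulfI (mulf_neq0 padic2_two_neq0 padic2_two_neq0)).
  by rewrite mulr0 -ab'0 a'E b'E; ring.
by split; apply: padic2_separated => n; have [a' [b' []]] := div n; eauto.
Qed.

(** * The ring Z_2[omega] *)

HB.instance Definition _ (K : fieldExtType Q_2) :=
  GRing.RMorphism.copy (@Z2_to K) (in_alg K \o @FracField.tofrac Z_2).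

Section Eisenstein.
Variables (K : fieldExtType Q_2) (omega : K).
Hypothesis omega_root : omega ^+ 2 + omega + 1 = 0.
Local Notation iota := (@Z2_to K).

Definition eisenstein : set K :=
  [set x | exists a b, x = iota a + iota b * omega].

(** Membership in 2^k Z_2[omega], phrased as a division to match the basic
    neighbourhoods of 0 in the definition of convergence. *)
Definition eis_pow2 k (x : K) : Prop := eisenstein (x / 2 ^+ k).

Lemma Z2_to_inj : injective iota.
Proof.
move=> a b eq_ab; apply/eqP; rewrite -tofrac_eq; apply/eqP.
by apply: (fmorph_inj (in_alg K)); exact: eq_ab.
Qed.

Lemma two_neq0 : (2 : K) != 0.
Proof.
rewrite -(rmorph_nat iota 2) -(rmorph0 iota) (inj_eq Z2_to_inj).
exact: padic2_two_neq0.
Qed.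

Lemma omega_sqr : omega ^+ 2 = - omega - 1.
Proof. by apply/eqP; rewrite -subr_eq0 opprD !opprK addrA omega_root. Qed.

Lemma eis_iota a : eisenstein (iota a).
Proof. by exists a, 0; rewrite rmorph0 mul0r addr0. Qed.

Lemma eis_omega : eisenstein omega.
Proof. by exists 0, 1; rewrite rmorph0 rmorph1 mul1r add0r. Qed.

Lemma eis_nat n : eisenstein n%:R.
Proof. by rewrite -(rmorph_nat iota); apply: eis_iota. Qed.

Lemma eisD x y : eisenstein x -> eisenstein y -> eisenstein (x + y).
Proof.
move=> [a [b ->]] [c [d ->]]; exists (a + c), (b + d).
by rewrite !rmorphD mulrDl addrACA.
Qed.

Lemma eisM x y : eisenstein x -> eisenstein y -> eisenstein (x * y).
Proof.
move=> [a [b ->]] [c [d ->]]; exists (a * c - b * d), (a * d + b * c - b * d).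
rewrite !(rmorphD, rmorphB, rmorphM); ring: omega_sqr.
Qed.

Lemma eisN x : eisenstein x -> eisenstein (- x).
Proof. by rewrite -mulN1r -(rmorphN1 iota); apply: eisM; apply: eis_iota. Qed.

Lemma eisB x y : eisenstein x -> eisenstein y -> eisenstein (x - y).
Proof. by move=> Ax Ay; apply: eisD => //; apply: eisN. Qed.

Lemma eisX x n : eisenstein x -> eisenstein (x ^+ n).
Proof.
move=> Ax; elim: n => [|n IHn]; first exact: (eis_nat 1).
by rewrite exprS; apply: eisM.
Qed.

Lemma eis_norm a b :
  (iota a + iota b * omega) * (iota a - iota b - iota b * omega)
  = iota (a ^+ 2 - a * b + b ^+ 2).
Proof. rewrite !(rmorphD, rmorphB, rmorphM, rmorphXn); ring: omega_sqr. Qed.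

(** A relation a + b omega = 0, multiplied by the conjugate, makes the norm of
    (a, b) vanish. *)
Lemma eis_free a b : iota a + iota b * omega = 0 -> a = 0 /\ b = 0.
Proof.
move=> ab0; apply: padic2_norm_eq0; apply: Z2_to_inj.
by rewrite -eis_norm ab0 mul0r rmorph0.
Qed.

Lemma eis_inj a b c d :
  iota a + iota b * omega = iota c + iota d * omega -> a = c /\ b = d.
Proof.
move=> eq_x; suff [/subr0_eq ? /subr0_eq ?] : a - c = 0 /\ b - d = 0 by [].
by apply: eis_free; rewrite !rmorphB mulrBl addrACA -opprD eq_x subrr.
Qed.

Lemma eis_pow2P k x : eis_pow2 k x <-> exists2 y, eisenstein y & x = 2 ^+ k * y.
Proof.
have nz2k : (2 ^+ k : K) != 0 by rewrite expf_neq0 ?two_neq0.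
split=> [Ax | [y Ay ->]]; last by rewrite /eis_pow2 mulrC mulKf.
by exists (x / 2 ^+ k) => //; rewrite mulrC divfK.
Qed.

Lemma eis_pow2_0 x : eis_pow2 0 x <-> eisenstein x.
Proof. by rewrite /eis_pow2 divr1. Qed.

Lemma eis_pow2_zero k : eis_pow2 k 0.
Proof. by rewrite /eis_pow2 mul0r; apply: (eis_nat 0). Qed.

Lemma eis_pow2D k x y : eis_pow2 k x -> eis_pow2 k y -> eis_pow2 k (x + y).
Proof. by rewrite /eis_pow2 mulrDl; apply: eisD. Qed.

Lemma eis_pow2B k x y : eis_pow2 k x -> eis_pow2 k y -> eis_pow2 k (x - y).
Proof. by rewrite /eis_pow2 mulrBl; apply: eisB. Qed.

Lemma eis_pow2N k x : eis_pow2 k x -> eis_pow2 k (- x).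
Proof. by rewrite /eis_pow2 mulNr; apply: eisN. Qed.

Lemma eis_pow2_swap k x y : eis_pow2 k (x - y) -> eis_pow2 k (y - x).
Proof. by move/eis_pow2N; rewrite opprB. Qed.

Lemma eis_pow2_trans k x y z :
  eis_pow2 k (x - y) -> eis_pow2 k (y - z) -> eis_pow2 k (x - z).
Proof. by move=> Axy Ayz; rewrite -[x](subrK y) -addrA; apply: eis_pow2D. Qed.

Lemma eis_pow2M j k x y :
  eis_pow2 j x -> eis_pow2 k y -> eis_pow2 (j + k) (x * y).
Proof. by rewrite /eis_pow2 exprD invfM mulrACA; apply: eisM. Qed.

Lemma eis_pow2Ml k x y : eisenstein x -> eis_pow2 k y -> eis_pow2 k (x * y).
Proof. by move/eis_pow2_0; apply: eis_pow2M. Qed.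

Lemma eis_pow2_exp2 k : eis_pow2 k (2 ^+ k).
Proof. by apply/eis_pow2P; exists 1; rewrite ?mulr1 //; apply: (eis_nat 1). Qed.

Lemma eis_pow2W j k x : (j <= k)%N -> eis_pow2 k x -> eis_pow2 j x.
Proof.
move=> le_jk /eis_pow2P[y Ay ->]; rewrite -(subnKC le_jk) exprD -mulrA.
apply/eis_pow2P; eexists; last by [].
by apply: eisM => //; apply: eisX; apply: eis_nat.
Qed.

Lemma eis_pow2_eis k x : eis_pow2 k x -> eisenstein x.
Proof. by move/(eis_pow2W (leq0n k))/eis_pow2_0. Qed.

Lemma eis_pow2_sum k (I : Type) (r : seq I) (P : pred I) (F : I -> K) :
  (forall i, P i -> eis_pow2 k (F i)) -> eis_pow2 k (\sum_(i <- r | P i) F i).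
Proof.
move=> AF; apply: (big_ind (eis_pow2 k)) => //.
  exact: eis_pow2_zero.
exact: eis_pow2D.
Qed.

Lemma eis_pow2_coord k a b :
  eis_pow2 k (iota a + iota b * omega) <->
  (exists a', a = 2 ^+ k * a') /\ (exists b', b = 2 ^+ k * b').
Proof.
have scale c d : 2 ^+ k * (iota c + iota d * omega)
    = iota (2 ^+ k * c) + iota (2 ^+ k * d) * omega.
  by rewrite !rmorphM !rmorphXn !rmorph_nat mulrDr mulrA.
split=> [/eis_pow2P[_ [c [d ->]]]|[[a' ->] [b' ->]]].
  by rewrite scale => /eis_inj[-> ->]; split; eexists.
by rewrite -scale; apply/eis_pow2P; eexists; [eexists; eexists|].
Qed.

Lemma eis_separated x : (forall k, eis_pow2 k x) -> x = 0.
Proof.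
move=> Ax; have /eis_pow2_eis[a [b xE]] := Ax 0.
have div k := (eis_pow2_coord k a b).1 (eq_ind _ _ (Ax k) _ xE).
rewrite xE (@padic2_separated a) => [|k]; last by case: (div k).
rewrite (@padic2_separated b) => [|k]; last by case: (div k).
by rewrite !rmorph0 mul0r addr0.
Qed.

(** Completeness is inherited from Z_2 coordinate by coordinate, because 2^k
    divides a + b omega exactly when it divides a and b. *)
Lemma eis_complete (u : nat -> K) :
  (forall n, eisenstein (u n)) -> (forall n, eis_pow2 n (u n.+1 - u n)) ->
  exists2 l, eisenstein l & forall n, eis_pow2 n (l - u n).
Proof.
move=> /choice[a /choice[b uE]] cau_u.
have diffE c d c' d' : iota c + iota d * omega - (iota c' + iota d' * omega)
    = iota (c - c') + iota (d - d') * omega.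
  by rewrite !rmorphB mulrBl opprD addrACA.
have cau n := (eis_pow2_coord n _ _).1 (eq_ind _ _ (cau_u n) _
  (etrans (congr2 (fun x y => x - y) (uE n.+1) (uE n)) (diffE _ _ _ _))).
have [la la_lim] := @padic2_complete a (fun n => (cau n).1).
have [lb lb_lim] := @padic2_complete b (fun n => (cau n).2).
exists (iota la + iota lb * omega) => [|n]; first by exists la, lb.
by rewrite uE diffE; apply/eis_pow2_coord.
Qed.

(** If 2 does not divide x, its norm is a unit of Z_2, and the inverse of x is its
    conjugate divided by the norm. *)
Lemma eis_unit x : eisenstein x -> eis_pow2 1 x \/ x != 0 /\ eisenstein x^-1.
Proof.
move=> [a [b {x}->]].
case: (padic2_norm_odd a b) => [[[a' aE] [b' bE]]|[t normE]].
  by left; apply/eis_pow2_coord; rewrite expr1; split; [exists a' | exists b'].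
have [v v_norm] := padic2_odd_unit t.
have xV : (iota a + iota b * omega)
    * ((iota a - iota b - iota b * omega) * iota v) = 1.
  by rewrite mulrA eis_norm normE -rmorphM mulrC v_norm rmorph1.
right; set x := iota a + iota b * omega in xV *.
have nz_x : x != 0.
  by apply/eqP => x0; move/eqP: xV; rewrite x0 mul0r eq_sym oner_eq0.
split=> //; rewrite -[x^-1]mulr1 -xV mulKf //.
apply: eisM (eis_iota v); exists (a - b), (- b).
by rewrite rmorphB rmorphN mulNr.
Qed.

Lemma eis_one_not_even : ~ eis_pow2 1 1.
Proof.
have -> : 1 = iota 1 + iota 0 * omega by rewrite rmorph1 rmorph0 mul0r addr0.
case/eis_pow2_coord => -[c]; rewrite expr1 => /(congr1 (fun x => residue x 1)).
rewrite padic2_residueM -(expr1 2%R) padic2_residue_exp2 modzz mul0r mod0z.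
by [].
Qed.

(** Dividing by 2 as long as possible terminates, since no nonzero element is
    divisible by all powers of 2. *)
Lemma eis_factor x : eisenstein x -> x != 0 ->
  exists j u, [/\ x = 2 ^+ j * u, u != 0, eisenstein u & eisenstein u^-1].
Proof.
move=> Ax nz_x; have [n] : exists n, ~ eis_pow2 n x.
  apply: contrapT => all_x; case/eqP: nz_x; apply: eis_separated => k.
  by apply: contrapT => nx; apply: all_x; exists k.
elim: n x Ax {nz_x} => [|n IHn] x Ax nAx; first by case: nAx; apply/eis_pow2_0.
have [/eis_pow2P[y Ay xE] | [nz_x AVx]] := eis_unit Ax; last first.
  by exists 0, x; rewrite mul1r.
have [|j [u [yE nz_u Au AVu]]] := IHn y Ay.
  move=> Any; apply: nAx; rewrite xE -add1n.
  exact: eis_pow2M (eis_pow2_exp2 1) Any.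
by exists j.+1, u; rewrite xE yE mulrA -exprD.
Qed.
End Eisenstein.

(** * The ring of integers and its maximal ideal *)

Lemma fraction_num_den (R : idomainType) (q : {fraction R}) :
  exists n d : R, d != 0 /\ q * FracField.tofrac d = FracField.tofrac n.
Proof.
elim/quotW: q => r; exists (frac r).1, (frac r).2.
split; first exact: denom_ratioP.
unlock FracField.tofrac; rewrite -[LHS]FracField.pi_mul; apply/eqmodP.
rewrite /= FracField.equivfE /FracField.mulf.
by rewrite !numden_Ratio ?mulr1 ?oner_eq0 ?mulf_neq0 ?denom_ratioP // mulrC.
Qed.

Section RingOfIntegers.
Variables (K : fieldExtType Q_2) (omega : K).
Hypothesis omega_root : omega ^+ 2 + omega + 1 = 0.
Hypothesis omega_gen : <<1; omega>>%VS = fullv.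
Local Notation iota := (@Z2_to K).
Local Notation eisenstein := (eisenstein omega).
Local Notation eis_pow2 := (eis_pow2 omega).

(** Elements of K are polynomial expressions in omega over Q_2; Horner's scheme
    allows the denominators to be cleared one coefficient at a time. *)
Lemma eis_clear_denom x : exists2 c, c != 0 & eisenstein (iota c * x).
Proof.
have : x \in <<1; omega>>%VS by rewrite omega_gen memvf.
case/Fadjoin1_polyP => p ->{x}; elim/poly_ind: p => [|p q [c nz_c Acp]].
  exists 1; first exact: oner_neq0.
  by rewrite rmorph0 horner0 mulr0; apply: (eis_nat omega 0).
have [n [d [nz_d qdE]]] := fraction_num_den q.
have {}qdE : iota d * in_alg K q = iota n.
  rewrite -[iota d]/(in_alg K (FracField.tofrac d)) -rmorphM mulrC qdE.
  by [].
exists (c * d); first exact: mulf_neq0.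
rewrite rmorphD rmorphM /= map_polyX map_polyC hornerMXaddC mulrDr !rmorphM.
apply: eisD; last by rewrite -mulrA qdE -rmorphM; apply: eis_iota.
rewrite mulrACA; apply: (eisM omega_root) => //.
by apply: (eisM omega_root (eis_iota omega d)); apply: eis_omega.
Qed.

(** Z_2[omega] is a valuation ring of K, with uniformizer 2. *)
Lemma eis_valuation x : eisenstein x \/ x != 0 /\ eis_pow2 1 x^-1.
Proof.
have [->|nz_x] := eqVneq x 0; first by left; apply: (eis_nat omega 0).
have [c nz_c Acx] := eis_clear_denom x.
have nz_ic : iota c != 0 by rewrite -(rmorph0 iota) (inj_eq (@Z2_to_inj K)).
have [i [v [cE nz_v Av AVv]]] := eis_factor omega_root (eis_iota omega c) nz_ic.
have [j [u [cxE nz_u Au AVu]]] :=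
  eis_factor omega_root Acx (mulf_neq0 nz_ic nz_x).
have nz2 n : (2 ^+ n : K) != 0 by rewrite expf_neq0 ?two_neq0.
have xE : x = 2 ^+ j * u / (2 ^+ i * v) by rewrite -cxE -cE mulrC mulKf.
have [le_ij|lt_ji] := leqP i j; [left | right; split=> //].
  have -> : x = 2 ^+ (j - i) * (u * v^-1).
    by rewrite xE -{1}(subnKC le_ij) exprD; field; rewrite nz_v nz2.
  by apply: (eisM omega_root); [apply/eisX/eis_nat | apply: (eisM omega_root)].
have -> : x^-1 = 2 ^+ (i - j) * (v * u^-1).
  by rewrite xE -{1}(subnKC (ltnW lt_ji)) exprD; field; rewrite nz_u nz_v !nz2.
apply: (@eis_pow2W _ _ omega_root 1 (i - j)); first by rewrite subn_gt0.
by apply/eis_pow2P; eexists; last by []; apply: (eisM omega_root).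
Qed.

(** A root x of a monic polynomial of degree n that lies outside Z_2[omega] has
    its inverse in 2 Z_2[omega]; multiplying the equation by x^-n would then make
    1 even. *)
Lemma ring_of_integersE : ring_of_integers K = eisenstein.
Proof.
apply/seteqP; split=> [x [p mon_p /rootP px0] | _ [a [b ->]]]; last first.
  have int_iota c : integralOver iota (iota c) by apply: (integral_id iota).
  apply: (integral_add (RtoK := iota)) => //; apply: integral_mul => //.
  apply: (@integral_root_monic _ _ iota omega ('X^2 + 'X + 1)).
  - have sz : size ('X^2 + 'X + 1 : {poly K}) = 3.
      by rewrite -addrA size_polyDl size_polyXn // -polyC1 size_XaddC.
    by rewrite monicE lead_coefE sz !coefE /= !addr0.
  - by rewrite /root !hornerE omega_root.
  apply/(@integral_poly _ _ iota) => i; rewrite !coefE.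
  do ![apply: integral_add | apply: integral_nat].
have [//|[nz_x Axv]] := eis_valuation x.
case: (@eis_one_not_even K omega omega_root).
have := mon_p; rewrite monicE => /eqP lead1.
have [n size_p] : exists n, size p = n.+1.
  by exists (size p).-1; rewrite prednK // size_poly_gt0 monic_neq0.
move: px0; rewrite horner_coef size_map_inj_poly ?rmorph0 //; last first.
  exact: Z2_to_inj.
rewrite size_p big_ord_recr /= coef_map /=.
have -> : p`_n = 1 by rewrite -lead1 lead_coefE size_p.
rewrite rmorph1 mul1r addrC => /eqP; rewrite addr_eq0 => /eqP xnE.
have -> : 1 = x ^+ n * x^-1 ^+ n by rewrite -exprMn divff ?expr1n.
rewrite xnE mulNr; apply: eis_pow2N => //; rewrite mulr_suml.
apply: eis_pow2_sum => // i _; rewrite coef_map -mulrA; apply: eis_pow2Ml => //.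
  exact: eis_iota.
have -> : x^-1 ^+ n = x^-1 ^+ (i + (n - i.+1).+1) by rewrite -addSnnS subnKC.
rewrite exprD mulrA -exprMn divff // expr1n mul1r exprSr.
apply: eis_pow2Ml => //; apply: eisX => //.
exact: (eis_pow2_eis omega_root Axv).
Qed.

(** The elements of Z_2[omega] outside 2 Z_2[omega] are units, so every ideal is
    either contained in 2 Z_2[omega] or everything. *)
Lemma max_idealE : max_ideal K = [set x | eis_pow2 1 x].
Proof.
have idealP1 : is_ideal eisenstein [set x | eis_pow2 1 x].
  split=> [x||x y|a x] /=.
  - exact: eis_pow2_eis.
  - exact: eis_pow2_zero.
  - exact: eis_pow2D.
  - exact: eis_pow2Ml.
have P1_max J : is_ideal eisenstein J ->
    J `<=` [set x | eis_pow2 1 x] \/ J = eisenstein.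
  case=> JA J0 JD JM.
  have [[x [Jx nPx]]|noJ] := pselect (exists x, J x /\ ~ eis_pow2 1 x).
    right; apply/seteqP; split=> // y Ay.
    have [//|[nz_x AVx]] := eis_unit omega_root (JA x Jx).
    by rewrite -(divfK nz_x y); apply: JM => //; apply: (eisM omega_root).
  by left=> x Jx; apply: contrapT => nPx; apply: noJ; exists x.
have P1_neqA : [set x | eis_pow2 1 x] <> eisenstein.
  move=> eqPA; apply: (eis_one_not_even omega_root).
  rewrite -[eis_pow2 1 1]/([set x | eis_pow2 1 x] 1) eqPA.
  exact: (eis_nat omega 1).
rewrite /max_ideal ring_of_integersE.
apply: xget_unique => [|I [idealI neqIA maxI]].
  split=> // J idealJ subJ; have [subJ'|->] := P1_max J idealJ; last by right.
  by left; apply/seteqP; split.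
have [subI|//] := P1_max I idealI; apply: esym.
by have [||//] := maxI _ idealP1.
Qed.
End RingOfIntegers.

(** * The logarithm series *)

(** A crude bound on v_2(n), sufficient to make 2^n / n tend to 0. *)
Lemma logn2_half n : (logn 2 n <= n./2)%N.
Proof.
have [->|n_gt0] := posnP n; first by rewrite logn0.
have : (2 ^ logn 2 n <= n)%N by apply: dvdn_leq => //; apply: pfactor_dvdnn.
case: (logn 2 n) => // v; have := ltn_expl v (isT : 1 < 2)%N; rewrite expnS.
by lia.
Qed.

Section Logarithm.
Variables (K : fieldExtType Q_2) (omega : K).
Hypothesis omega_root : omega ^+ 2 + omega + 1 = 0.
Hypothesis omega_gen : <<1; omega>>%VS = fullv.
Local Notation iota := (@Z2_to K).
Local Notation eisenstein := (eisenstein omega).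
Local Notation eis_pow2 := (eis_pow2 omega).

(** Division by n costs v_2(n) binary digits, the odd part being a unit. *)
Lemma nat_inv_logn2 n : (0 < n)%N ->
  exists2 w : K, eisenstein w & n%:R^-1 = w / 2 ^+ logn 2 n.
Proof.
move=> n_gt0; have [m odd_m nE] := pfactor_coprime (isT : prime 2) n_gt0.
rewrite coprime2n in odd_m.
have [v v_m] := padic2_odd_unit (m./2%:R).
have mE : m%:R = 1 + 2 * m./2%:R :> Z_2.
  by rewrite -{1}(odd_double_half m) odd_m natrD -mul2n natrM.
have {}v_m : iota v * m%:R = 1.
  by rewrite -(rmorph_nat iota) -rmorphM mE v_m rmorph1.
exists (iota v); first exact: eis_iota.
rewrite [in LHS]nE natrM natrX invfM; congr (_ / _).
have nz_m : (m%:R : K) != 0.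
  by apply/eqP => m0; move/eqP: v_m; rewrite m0 mulr0 eq_sym oner_eq0.
by apply: (mulIf nz_m); rewrite mulVf // v_m.
Qed.

Lemma eis_pow2_div k n x : (0 < n)%N -> eis_pow2 (k + logn 2 n) x ->
  eis_pow2 k (x / n%:R).
Proof.
move=> n_gt0 /eis_pow2P[y Ay ->]; have [w Aw ->] := nat_inv_logn2 n_gt0.
have nz2 m : (2 ^+ m : K) != 0 by rewrite expf_neq0 ?two_neq0.
apply/eis_pow2P; exists (w * y); first exact: eisM.
by rewrite exprD; field; rewrite nz2.
Qed.

Lemma log_term_small x n k : eisenstein x -> (k + n./2 <= n)%N -> (0 < n)%N ->
  eis_pow2 k ((-1) ^+ n.-1 * ((2 * x) ^+ n / n%:R)).
Proof.
move=> Ax le_kn n_gt0; apply: (eis_pow2Ml omega_root).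
  by apply: (eisX omega_root); apply: eisN => //; apply: (eis_nat omega 1).
apply: eis_pow2_div => //; apply: (@eis_pow2W _ _ omega_root _ n).
  by apply: leq_trans le_kn; rewrite leq_add2l logn2_half.
rewrite exprMn; apply/eis_pow2P; eexists; last by [].
exact: (eisX omega_root).
Qed.

(** Squaring a congruence modulo 2^k with k > 0 gains one digit, since
    v^2 - u^2 = (v - u) ((v - u) + 2 u); raising it to an odd power loses none. *)
Lemma eis_pow2_expB k n x y : (0 < k)%N -> eisenstein x -> eisenstein y ->
  eis_pow2 k (y - x) -> eis_pow2 (k + logn 2 n) (y ^+ n - x ^+ n).
Proof.
move=> k_gt0 Ax Ay Axy.
have expB m i u v : eisenstein u -> eisenstein v -> eis_pow2 i (v - u) ->
    eis_pow2 i (v ^+ m - u ^+ m).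
  move=> Au Av Auv; rewrite subrXX mulrC; apply: (eis_pow2Ml omega_root) => //.
  apply/(eis_pow2_0 omega); apply: eis_pow2_sum => // j _; apply/eis_pow2_0.
  by apply: (eisM omega_root); apply: (eisX omega_root).
have [->|n_gt0] := posnP n; first by rewrite !expr0 subrr; apply: eis_pow2_zero.
have [m _] := pfactor_coprime (isT : prime 2) n_gt0.
move: (logn 2 n) => v ->; rewrite !exprM.
elim: v => [|v IHv]; first by rewrite addn0 !expr1; apply: expB.
set b := _ ^+ (2 ^ v) in IHv; set a := _ ^+ (2 ^ v) in IHv.
have Aa : eisenstein a by do 2!apply: (eisX omega_root).
have -> : (y ^+ m) ^+ (2 ^ v.+1) - (x ^+ m) ^+ (2 ^ v.+1)
    = (b - a) * ((b - a) + 2 * a).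
  by rewrite expnSr !exprM -/a -/b; ring.
rewrite addnS -addn1; apply: (eis_pow2M omega_root) => //; apply: eis_pow2D => //.
  by apply: (eis_pow2W omega_root) IHv; rewrite addn_gt0 k_gt0.
by apply/eis_pow2P; exists a; rewrite ?expr1.
Qed.

Lemma log_partial_sumB (x : K) M N : (M <= N)%N ->
  log_partial_sum x N - log_partial_sum x M
  = \sum_(M.+1 <= n < N.+1) (-1) ^+ n.-1 * (x ^+ n / n%:R).
Proof.
move=> le_MN; rewrite /log_partial_sum (@big_cat_nat _ _ _ M.+1) //=.
by rewrite addrAC subrr add0r.
Qed.

Lemma log_tail x k M N : eisenstein x -> (k + k <= M.+1)%N -> (M <= N)%N ->
  eis_pow2 k (log_partial_sum (2 * x) N - log_partial_sum (2 * x) M).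
Proof.
move=> Ax le_kM le_MN; rewrite log_partial_sumB // big_nat_cond.
apply: eis_pow2_sum => // n /andP[/andP[lt_Mn _] _].
by apply: log_term_small => //; lia.
Qed.

Lemma converges_toE (u : nat -> K) l :
  converges_to u l <->
  forall k, exists N, forall n, (N <= n)%N -> eis_pow2 k (u n - l).
Proof. by rewrite /converges_to (ring_of_integersE omega_root omega_gen). Qed.

Lemma converges_to_unique (u : nat -> K) l l' :
  converges_to u l -> converges_to u l' -> l = l'.
Proof.
move=> /converges_toE u_l /converges_toE u_l'; apply/subr0_eq.
apply: (eis_separated omega_root) => k.
have [N uN] := u_l k; have [N' uN'] := u_l' k.
apply: (@eis_pow2_trans _ _ _ _ (u (N + N')%N)); last exact: uN' (leq_addl _ _).
by apply: eis_pow2_swap => //; apply: uN (leq_addr _ _).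
Qed.

(** Convergence of the series with an explicit rate: from n - v_2(n) >= n / 2, the
    first 2 k terms determine the sum modulo 2^k. *)
Lemma logM_approx x k N : eisenstein x -> (k + k <= N)%N ->
  eis_pow2 k (log_partial_sum (2 * x) N - logM (2 * x)).
Proof.
move=> Ax; pose S := log_partial_sum (2 * x).
have AS n : eisenstein (S n).
  apply/(eis_pow2_0 omega); rewrite /S /log_partial_sum big_nat_cond.
  apply: eis_pow2_sum => // i /andP[/andP[i_gt0 _] _].
  by apply: log_term_small => //; lia.
have [|n|l _ S_l] := @eis_complete K omega omega_root (fun n => S (n + n)%N).
- by move=> n; apply: AS.
- by apply: log_tail => //; lia.
have limS i n : (i + i <= n)%N -> eis_pow2 i (S n - l).
  move=> le_in; apply: (@eis_pow2_trans _ _ _ _ (S (i + i)%N)).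
    by apply: log_tail.
  exact: eis_pow2_swap.
have cvS : converges_to S l.
  by apply/converges_toE => i; exists (i + i)%N => n; apply: limS.
have -> : logM (2 * x) = l; last exact: limS.
by apply: xget_unique => // l' cvS'; apply: converges_to_unique cvS' cvS.
Qed.

(** The terms (2 x)^n / n of the series are divisible by 4 for n >= 3. *)
Lemma logM_mod4 x :
  eisenstein x -> eis_pow2 2 (logM (2 * x) - 2 * (x - x ^+ 2)).
Proof.
move=> Ax; apply: (@eis_pow2_trans _ _ _ _ (log_partial_sum (2 * x) 4)).
  by apply: eis_pow2_swap => //; apply: logM_approx.
have -> : 2 * (x - x ^+ 2) = log_partial_sum (2 * x) 2.
  rewrite /log_partial_sum 2?big_ltn // big_geq //=; field.
  by rewrite two_neq0 oner_neq0.
rewrite log_partial_sumB // big_nat_cond.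
apply: eis_pow2_sum => // n /andP[/andP[lt_2n _] _].
by apply: log_term_small => //; lia.
Qed.

(** The linear term of the series contributes 2 d exactly.  The n-th term changes
    by (2^n / n) ((x + d)^n - x^n), where the v_2(n) digits lost in the division
    are those gained by [eis_pow2_expB]; this leaves divisibility by 2^(n + k),
    and n is at least 2. *)
Lemma logM_increment x d k : (0 < k)%N -> eisenstein x -> eis_pow2 k d ->
  eis_pow2 k.+2 (logM (2 * (x + d)) - logM (2 * x) - 2 * d).
Proof.
move=> k_gt0 Ax Pd; have Ad := eis_pow2_eis omega_root Pd.
have Axd : eisenstein (x + d) by apply: eisD.
pose N := (k.+2 + k.+2)%N; pose S (y : K) := log_partial_sum (2 * y) N.
have approx y : eisenstein y -> eis_pow2 k.+2 (S y - logM (2 * y)).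
  by move=> Ay; apply: logM_approx.
have -> : logM (2 * (x + d)) - logM (2 * x) - 2 * d =
    (S (x + d) - S x - 2 * d) - (S (x + d) - logM (2 * (x + d)))
    + (S x - logM (2 * x)).
  by ring.
apply: eis_pow2D; last exact: approx.
apply: (eis_pow2B omega_root); last exact: approx.
have SE y : S y = 2 * y
    + \sum_(2 <= n < N.+1) (-1) ^+ n.-1 * ((2 * y) ^+ n / n%:R).
  by rewrite /S /log_partial_sum big_ltn //= mul1r divr1.
rewrite !SE; set s1 := \sum_(_ <= _ < _) _; set s0 := \sum_(_ <= _ < _) _.
have -> : 2 * (x + d) + s1 - (2 * x + s0) - 2 * d = s1 - s0 by ring.
rewrite -sumrB big_nat_cond; apply: eis_pow2_sum => // n /andP[/andP[lt_1n _] _].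
rewrite -mulrBr -mulrBl; apply: (eis_pow2Ml omega_root).
  by apply: (eisX omega_root); apply: eisN => //; apply: (eis_nat omega 1).
apply: eis_pow2_div; first exact: ltnW.
rewrite !exprMn -mulrBr.
apply: (@eis_pow2W _ _ omega_root _ (n + (k + logn 2 n))); first by lia.
apply: (eis_pow2M omega_root); first exact: eis_pow2_exp2.
by apply: eis_pow2_expB => //; rewrite addrAC subrr add0r.
Qed.
End Logarithm.

(** * The image of the logarithm *)

Section Image.
Variables (K : fieldExtType Q_2) (omega : K).
Hypothesis omega_root : omega ^+ 2 + omega + 1 = 0.
Hypothesis omega_gen : <<1; omega>>%VS = fullv.
Local Notation iota := (@Z2_to K).
Local Notation eisenstein := (eisenstein omega).
Local Notation eis_pow2 := (eis_pow2 omega).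

Lemma eis_pow2_half k x : eis_pow2 k.+1 x -> eis_pow2 k (x / 2).
Proof. by rewrite /eis_pow2 exprS invfM mulrA. Qed.

(** Newton iteration, with the derivative of z |-> log (1 + 2 z) replaced by the
    constant 2, to which it is congruent modulo 4.  Starting with an error in
    4 Z_2[omega], each step gains one digit. *)
Lemma logM_lift x0 y : eisenstein x0 -> eis_pow2 2 (logM (2 * x0) - y) ->
  exists2 x, eisenstein x & logM (2 * x) = y.
Proof.
move=> Ax0 log_x0; pose L (z : K) := logM (2 * z).
pose newton (z : K) := z - (L z - y) / 2; pose u n := iter n newton x0.
have uP n : eisenstein (u n) /\ eis_pow2 n.+2 (L (u n) - y).
  elim: n => [//|n [Au Lu]] /=; set z := u n in Au Lu *.
  have Pd : eis_pow2 n.+1 (- ((L z - y) / 2)) by apply/eis_pow2N/eis_pow2_half.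
  split; first by apply: eisD => //; apply: eis_pow2_eis Pd.
  have := logM_increment omega_root omega_gen (ltn0Sn n) Au Pd.
  have -> : 2 * - ((L z - y) / 2) = - (L z - y) by field; rewrite two_neq0.
  by rewrite opprK addrA subrK.
have [|n|x Ax u_x] := @eis_complete K omega omega_root u.
- by move=> n; case: (uP n).
- rewrite /u /= -/(u n) /newton addrAC subrr add0r; apply: eis_pow2N => //.
  by apply: eis_pow2_half; apply: (eis_pow2W omega_root) (uP n).2; apply: leqnSn.
exists x => //; apply/subr0_eq/(eis_separated omega_root) => k.
have [Au Lu] := uP k.+1; have Pd := u_x k.+1.
apply: (@eis_pow2_trans _ _ _ _ (L (u k.+1))); last first.
  by apply: (eis_pow2W omega_root) Lu; lia.
have := logM_increment omega_root omega_gen (ltn0Sn k) Au Pd.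
rewrite [u _ + _]addrC subrK => inc; rewrite -[_ - _](subrK (2 * (x - u k.+1))).
apply: eis_pow2D; first by apply: (eis_pow2W omega_root) inc; lia.
apply: (eis_pow2Ml omega_root); first exact: (eis_nat omega 2).
by apply: (eis_pow2W omega_root) Pd; lia.
Qed.

(** The coordinate of x - x^2 on omega is b + b^2 - 2 a b, which is even; hence
    that of log (1 + 2 x) is divisible by 4. *)
Lemma logM_image_sub a b : exists c d,
  logM (2 * (iota a + iota b * omega)) = iota c * 2 + iota d * (4 * omega).
Proof.
set x := iota a + _; have Ax : eisenstein x by exists a, b.
have [e eE] : exists e, b + b ^+ 2 = 2 * e.
  have [b' [] ->] := padic2_parity b; first by exists (b' + 2 * b' ^+ 2); ring.
  by exists (1 + 3 * b' + 2 * b' ^+ 2); ring.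
have /eis_pow2P[_ [c [d ->]]] := logM_mod4 omega_root omega_gen Ax.
move/eqP; rewrite subr_eq => /eqP ->.
exists (a - a ^+ 2 + b ^+ 2 + 2 * c), (e - a * b + d).
have -> : 2 * (x - x ^+ 2)
    = 2 * iota (a - a ^+ 2 + b ^+ 2)
      + 2 * iota (b + b ^+ 2 - 2 * (a * b)) * omega.
  rewrite /x !(rmorphD, rmorphB, rmorphM, rmorphXn, rmorph_nat).
  ring: (omega_sqr omega_root).
by rewrite eE !(rmorphD, rmorphB, rmorphM, rmorphXn, rmorph_nat); ring.
Qed.

(** Modulo 4 Z_2[omega], the target is 0 or 2 according to the parity of c; these
    are the classes of log 1 and of log (1 + 2 omega). *)
Lemma logM_image_sup c d : exists2 x, eisenstein x &
  logM (2 * x) = iota c * 2 + iota d * (4 * omega).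
Proof.
have [c' cE] := padic2_parity c.
have [x0 Ax0 x0E] : exists2 x0, eisenstein x0 &
    eis_pow2 2 (2 * (x0 - x0 ^+ 2) - (iota c * 2 + iota d * (4 * omega))).
  case: cE => ->.
    exists 0; first exact: (eis_nat omega 0).
    apply/eis_pow2P; exists (iota (- c') + iota (- d) * omega).
      by eexists; eexists.
    by rewrite !(rmorphN, rmorphM, rmorph_nat); ring.
  exists omega; first exact: eis_omega.
  apply/eis_pow2P; exists (iota (- c') + iota (1 - d) * omega).
    by eexists; eexists.
  rewrite !(rmorphD, rmorphB, rmorphN, rmorphM, rmorph_nat, rmorph1).
  ring: (omega_sqr omega_root).
apply: (logM_lift Ax0); apply: eis_pow2_trans x0E.
exact: logM_mod4.
Qed.
End Image.

Theorem theorem2p14 (K : fieldExtType Q_2) (omega : K)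
    (omega_root : omega ^+ 2 + omega + 1 = 0)
    (omega_gen : <<1; omega>>%VS = fullv) :
  is_Z2_basis (@logM K @` max_ideal K) [tuple 2; 4 * omega].
Proof.
have combE (a : 'I_2 -> Z_2) :
    \sum_(i < 2) Z2_to K (a i) * tnth [tuple 2; 4 * omega] i
    = Z2_to K (a ord0) * 2 + Z2_to K (a ord_max) * (4 * omega).
  rewrite !big_ord_recl big_ord0 addr0 !(tnth_nth 0) /=.
  by congr (_ + Z2_to K (a _) * _); apply: val_inj.
split=> [a|].
  rewrite combE => sum0.
  have [] : 2 * a ord0 = 0 /\ 4 * a ord_max = 0.
    apply: (eis_free omega_root); rewrite -sum0 !rmorphM !rmorph_nat; ring.
  have -> : 4 = 2 * 2 :> Z_2 by rewrite -natrM.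
  move=> /eqP; rewrite mulf_eq0 (negPf padic2_two_neq0) => /eqP a0.
  move=> /eqP; rewrite !mulf_eq0 (negPf padic2_two_neq0) => /eqP a1.
  move=> i; have : (i == ord0) || (i == ord_max) by case: i => [[|[|]]].
  by case/orP => /eqP ->.
rewrite (max_idealE omega_root omega_gen); apply/seteqP; split=> y /=.
  case=> _ /eis_pow2P[_ [a [b ->]]] -> <-; rewrite expr1.
  have [c [d ->]] := logM_image_sub omega_root omega_gen a b.
  by exists (fun i => if i == ord0 then c else d); rewrite combE.
case=> a ->; rewrite combE.
have [x Ax <-] := logM_image_sup omega_root omega_gen (a ord0) (a ord_max).
by exists (2 * x) => //; apply/eis_pow2P; exists x; rewrite ?expr1.
Qed.
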